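(* Let $n\ge 2$, let $X=(X_1,\dots,X_n)$ be a vector of i.i.d. real random variables with finite variance, and let $\Pi$ be a uniformly random permutation of $\{1,\dots,n\}$ independent of $X$. With $\overline{\mathrm{MR}}(X,\Pi)$, $\mathrm{GMD}(X)$, $\zeta_1$ and $\zeta_2$ as defined in the context, $$\mathrm{Var}\{\overline{\mathrm{MR}}(X,\Pi)\}=\frac{(n-1)\,\zeta_2+2(n-2)\,\zeta_1}{(n-1)^2},$$ $$\mathrm{Var}\{\mathrm{GMD}(X)\}=\frac{2\bigl\{\zeta_2+2(n-2)\,\zeta_1\bigr\}}{n(n-1)},$$ $$\mathbb{E}\bigl[\mathrm{Var}\{\overline{\mathrm{MR}}(X,\Pi)\mid X\}\bigr]=\frac{n-2}{n(n-1)}\left\{\zeta_2-\frac{2(n-2)}{n-1}\,\zeta_1\right\}.$$ Moreover, for $T(X,\Pi)=\overline{\mathrm{MR}}(X,\Pi)/d_2$ with $d_2=2/\sqrt{\pi}$, dividing each of the three right-hand sides by $d_2^2$ gives, respectively, $\mathrm{Var}\{T(X,\Pi)\}$, $\mathrm{Var}\bigl[\mathbb{E}\{T(X,\Pi)\mid X\}\bigr]$ and $\mathbb{E}\bigl[\mathrm{Var}\{T(X,\Pi)\mid X\}\bigr]$.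
   Context: The average moving range along the order $\Pi$ is $$\overline{\mathrm{MR}}(X,\Pi)=\frac{1}{n-1}\sum_{t=2}^{n}\bigl|X_{\Pi(t)}-X_{\Pi(t-1)}\bigr|,$$ and the sample Gini mean difference is $$\mathrm{GMD}(X)=\frac{2}{n(n-1)}\sum_{1\le i<j\le n}|X_i-X_j|.$$ The constants $\zeta_1,\zeta_2$ depend only on the common distribution of the $X_i$: with $D_{ij}=|X_i-X_j|$ (for $X_1,X_2,X_3$ i.i.d. from that distribution), $$\zeta_2=\mathrm{Var}(D_{12}),\qquad \zeta_1=\mathrm{Cov}(D_{12},D_{13}).$$ Conditional expectation and variance given $X$ are taken over the random permutation $\Pi$ with $X$ held fixed. The symbol $\pi$ in $d_2=2/\sqrt{\pi}$ is the circle constant. *)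

(* Defs.v *)
From HB Require Import structures.
From mathcomp Require Import all_boot all_order all_algebra all_fingroup.
From mathcomp Require Import all_classical all_reals all_analysis.
Set Implicit Arguments.
Unset Strict Implicit.
Unset Printing Implicit Defensive.
Import Order.TTheory GRing.Theory Num.Theory.
Import numFieldNormedType.Exports.
Local Open Scope classical_set_scope.
Local Open Scope ring_scope.

(* The indices 1, ..., n are represented by 'I_n = {0, ..., n-1}, so the terms
   t = 2, ..., n correspond to the ordinals t > 0, for which ord_pred t is the
   ordinal t - 1 (no wrap-around). *)
Definition MR (R : realType) (n : nat) (x : 'I_n -> R) (s : {perm 'I_n}) : R :=
  (n%:R - 1)^-1 *
  \sum_(t < n | (0 < t)%N) `|x (s t) - x (s (ord_pred t))|.

Definition GMD (R : realType) (n : nat) (x : 'I_n -> R) : R :=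
  2 / (n%:R * (n%:R - 1)) *
  \sum_(i < n) \sum_(j < n | (i < j)%N) `|x i - x j|.

Definition d2 (R : realType) : R := 2 / Num.sqrt pi.

Definition Tstat (R : realType) (n : nat) (x : 'I_n -> R) (s : {perm 'I_n}) : R :=
  MR x s / d2 R.

Section zeta.
Local Open Scope ereal_scope.
Context (R : realType) (mu : probability R R).

(* The law of three i.i.d. variables with distribution mu; a point is
   ((x1, x2), x3). *)
Definition iid3 : probability _ R := mu \x mu \x mu.

Definition D12 (p : R * R * R) : R :=
  `|p.1.1 - p.1.2|%R.

Definition D13 (p : R * R * R) : R :=
  `|p.1.1 - p.2|%R.

Definition zeta1 : \bar R := covariance iid3 D12 D13.

Definition zeta2 : \bar R := 'V_iid3[D12].

End zeta.

Section probability_notions.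
Local Open Scope ereal_scope.
Context (d : measure_display) (T : measurableType d) (R : realType).
Variables (P : probability T R) (n : nat).

Definition mutually_independent (X : 'I_n -> {RV P >-> R}) : Prop :=
  forall (J : {set 'I_n}) (A : 'I_n -> set R),
    (forall i, measurable (A i)) ->
    P (\bigcap_(i in [set` J]) (X i @^-1` A i)) =
    \prod_(i in J) P (X i @^-1` A i).

Definition has_law (Y : {RV P >-> R}) (mu : probability R R)
    : Prop :=
  forall A : set R, measurable A -> distribution P Y A = mu A.

(* {perm 'I_n} carries the discrete sigma-algebra. *)
Definition random_perm (Pi : T -> {perm 'I_n}) : Prop :=
  forall S : set {perm 'I_n}, measurable (Pi @^-1` S).

Definition uniform_perm (Pi : T -> {perm 'I_n}) : Prop :=
  forall s : {perm 'I_n}, P (Pi @^-1` [set s]) = ((n`!)%:R^-1)%:E.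

(* g_sigma_preimage X is the sigma-algebra generated by X_1, ..., X_n. *)
Definition independent_perm (X : 'I_n -> {RV P >-> R}) (Pi : T -> {perm 'I_n})
    : Prop :=
  forall (B : set T) (S : set {perm 'I_n}),
    g_sigma_preimage X B ->
    P (B `&` Pi @^-1` S) = P B * P (Pi @^-1` S).

(* For X and Pi independent, E{h(X, Pi) | X} and Var{h(X, Pi) | X} are the
   expectation and the variance over the random Pi with X frozen at its value
   at w.  Both are finite because Pi takes finitely many values. *)
Definition cond_expectation (h : ('I_n -> R) -> {perm 'I_n} -> R)
    (X : 'I_n -> {RV P >-> R}) (Pi : T -> {perm 'I_n}) (w : T) : R :=
  fine 'E_P[fun w' => h (fun i => X i w) (Pi w')].

Definition cond_variance (h : ('I_n -> R) -> {perm 'I_n} -> R)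
    (X : 'I_n -> {RV P >-> R}) (Pi : T -> {perm 'I_n}) (w : T) : R :=
  fine 'V_P[fun w' => h (fun i => X i w) (Pi w')].

End probability_notions.

(* Main.v *)
(* The covariance of |X_i - X_j| and |X_k - X_l| depends only on how many indices
   the two pairs share: zeta2, zeta1 or 0.  Both statistics are averages of such
   pair differences over index pairs, so their variances are obtained by counting
   overlaps: consecutive positions for the moving range, all off-diagonal pairs
   for GMD.  By 2-transitivity of the symmetric group, averaging the moving range
   over all permutations gives GMD, hence E[MR | X] = GMD and
   E[Var(MR | X)] = E[MR^2] - E[GMD^2] = Var(MR) - Var(GMD). *)
Require Import Defs.
From HB Require Import structures.
From mathcomp Require Import all_boot all_order all_algebra all_fingroup.
From mathcomp Require Import all_classical all_reals all_analysis.
From mathcomp Require Import measurable_realfun ring.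
Set Implicit Arguments.
Unset Strict Implicit.
Unset Printing Implicit Defensive.
Import Order.TTheory GRing.Theory Num.Theory.
Import numFieldNormedType.Exports.
Local Open Scope classical_set_scope.
Local Open Scope ring_scope.

(** * Means as integrability together with a real value *)

Section mean.
Context d (T : measurableType d) (R : realType) (P : probability T R).
Implicit Types f g : T -> R.

(** The delicate point is where each expectation lives. [zeta1] and [zeta2] are taken under the
    abstract product law [iid3], whereas finite variance is assumed for the [X i] under [P]; and for
    n = 2 there are no three distinct indices with which to realise [D12] and [D13] jointly on [T].
    Moments therefore travel between [P], [mu \x mu] and [iid3] by identifying the joint laws of
    two, three and four coordinates. All transferred functions are nonnegative, so a transfer
    requires no prior integrability. [is_mean] keeps integrability and value together because
    additivity of an extended-real expectation rests on integrability. As for the random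
    permutation, the first two moments of the moving range along a fixed [s] do not depend on [s];
    splitting on the finitely many values of [Pi] then reduces E[MR] and E[MR^2] to averages of
    constants. *)

Definition is_mean f (r : R) := f \in Lfun P 1 /\ 'E_P[f]%E = r%:E.

Lemma is_mean_cst (r : R) : is_mean (fun=> r) r.
Proof. by split; [exact: Lfun_cst | exact: expectation_cst]. Qed.

Lemma is_meanD f g a b :
  is_mean f a -> is_mean g b -> is_mean (fun w => f w + g w) (a + b).
Proof.
move=> [f1 fa] [g1 gb]; split; first exact: (rpredD f1 g1).
by rewrite (expectationD f1 g1) fa gb.
Qed.

Lemma is_meanZ k f a : is_mean f a -> is_mean (fun w => k * f w) (k * a).
Proof.
move=> [f1 fa]; have -> : (fun w => k * f w) = k \o* f.
  by apply/funext => w /=; rewrite mulrC.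
by split; [exact: Lfun_scale | rewrite expectationZl// fa].
Qed.

Lemma is_meanB f g a b :
  is_mean f a -> is_mean g b -> is_mean (fun w => f w - g w) (a - b).
Proof.
move=> fa /(is_meanZ (-1)) gb; rewrite -(mulN1r b).
by under eq_fun do rewrite -mulN1r; exact: is_meanD.
Qed.

Lemma is_mean_sum (I : Type) (r : seq I) (Q : pred I) (f : I -> T -> R)
    (a : I -> R) : (forall i, Q i -> is_mean (f i) (a i)) ->
  is_mean (fun w => \sum_(i <- r | Q i) f i w) (\sum_(i <- r | Q i) a i).
Proof.
move=> fa; elim: r => [|i r ih].
  by rewrite big_nil; under eq_fun do rewrite big_nil; exact: is_mean_cst.
rewrite big_cons; under eq_fun do rewrite big_cons.
by case: ifP => // Qi; apply: is_meanD => //; exact: fa.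
Qed.

Lemma is_mean_covariance f g a b c : is_mean f a -> is_mean g b ->
  is_mean (fun w => f w * g w) c -> covariance P f g = (c - a * b)%:E.
Proof.
move=> [f1 fa] [g1 gb] [fg1 fgc]; rewrite covarianceE// fa gb.
by rewrite [X in ('E_P[X] - _)%E](_ : _ = (fun w => f w * g w))// fgc.
Qed.

Lemma is_mean_variance f a b : is_mean f a ->
  is_mean (fun w => f w ^+ 2) b -> 'V_P[f]%E = (b - a ^+ 2)%:E.
Proof. by move=> fa fb; exact: is_mean_covariance. Qed.

Lemma is_mean_varianceZ c f a v : is_mean f a ->
  is_mean (fun w => f w ^+ 2) (a ^+ 2 + v) ->
  'V_P[(fun w => f w * c)%R]%E = (v * c ^+ 2)%:E.
Proof.
move=> /(is_meanZ c) fa /(is_meanZ (c ^+ 2)) fv.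
under eq_fun do rewrite mulrC.
rewrite (is_mean_variance fa (b := c ^+ 2 * (a ^+ 2 + v))).
  by congr EFin; ring.
by under eq_fun do rewrite exprMn.
Qed.

Lemma ge0_is_mean f r : measurable_fun setT f -> (forall w, 0 <= f w) ->
  (\int[P]_w (f w)%:E)%E = r%:E -> is_mean f r.
Proof.
move=> mf f0 fr; split; last by rewrite unlock.
apply/Lfun1_integrable/integrableP; split; first exact/measurable_EFinP.
under eq_integral do rewrite /= ger0_norm//.
by rewrite fr ltry.
Qed.

Lemma is_mean_integral f r : is_mean f r -> (\int[P]_w (f w)%:E)%E = r%:E.
Proof. by case=> _; rewrite unlock. Qed.

Lemma Lfun2_sqr_integrable f : measurable_fun setT f ->
  P.-integrable setT (EFin \o (fun w => f w ^+ 2)) -> f \in Lfun P 2%:E.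
Proof.
move=> mf /integrableP[_ foo]; rewrite inE/=; apply/andP; split; rewrite inE//=.
rewrite /finite_norm unlock poweR_lty//; apply: le_lt_trans foo.
rewrite le_eqVlt; apply/orP; left; apply/eqP.
by apply: eq_integral => w _; rewrite /= powR_mulrn// normrX.
Qed.

(** The variance is the integral of (f - c)^2 with [c] the [fine] part of the expectation, a real
    number whether or not the mean is finite. A finite variance thus puts f - c in L2, and constants
    belong to L2 of a probability. *)
Lemma Lfun2_variance f : measurable_fun setT f -> ('V_P[f] < +oo)%E ->
  f \in Lfun P 2%:E.
Proof.
move=> mf; rewrite /variance unlock unlock => foo.
set c := fine _ in foo.
have -> : f = (fun w => f w - c) \+ cst c.
  by apply/funext => w /=; rewrite subrK.
have fc2 : (fun w => f w - c) \in Lfun P 2%:E; last first.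
  by apply: rpredD; rewrite ?lee1n// => ?; exact: Lfun_cst.
apply: Lfun2_sqr_integrable; first exact: measurable_funB.
apply/integrableP; split.
  by apply/measurable_EFinP; apply: measurable_funX; exact: measurable_funB.
apply: le_lt_trans foo; rewrite le_eqVlt; apply/orP; left; apply/eqP.
by apply: eq_integral => w _ /=; rewrite ger0_norm ?sqr_ge0.
Qed.

End mean.

(** * Joint laws from rectangles, and transfer of means *)

Section law.
Context d d1 d2 (T : measurableType d) (T1 : measurableType d1)
  (T2 : measurableType d2) (R : realType).
Variables (P : probability T R) (m1 : probability T1 R) (m2 : probability T2 R).

(** Both sides are finite measures in [C]: the image of [P] restricted to [E], and the product
    measure scaled by P(E). They agree on rectangles, a pi-system generating the product
    sigma-algebra. The event [E] makes it possible to pass from rectangles to arbitrary sets in one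
    pair of coordinates while other coordinates stay constrained. *)
Lemma pair_law (U : T -> T1) (V : T -> T2) (E : set T) :
  measurable_fun setT U -> measurable_fun setT V -> measurable E ->
  (forall A B, measurable A -> measurable B ->
    P (U @^-1` A `&` V @^-1` B `&` E) = (m1 A * m2 B * P E)%E) ->
  forall C, measurable C ->
    P ((fun w => (U w, V w)) @^-1` C `&` E) = ((m1 \x m2)%E C * P E)%E.
Proof.
move=> mU mV mE UVE C mC.
have mUV : measurable_fun setT (fun w => (U w, V w)).
  exact: measurable_fun_pair.
have PE : P E = (fine (P E))%:E by rewrite fineK// fin_num_measure.
pose k : {nonneg R} := NngNum (fine_ge0 (measure_ge0 P E)).
pose lhs : {measure set (T1 * T2) -> \bar R} :=
  pushforward (mrestr P mE) (fun w => (U w, V w)).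
pose rhs : {measure set (T1 * T2) -> \bar R} := mscale k (m1 \x m2)%E.
rewrite muleC [in RHS]PE; suff : lhs mUV C = rhs C by [].
apply: (@measure_unique _ R _ [set A `*` B | A in measurable & B in measurable]
  (fun=> setT) _ _ _ _ (lhs mUV) rhs) => //.
- exact: measurable_prod_measurableType.
- move=> _ _ [A mA [B mB <-]] [A' mA' [B' mB' <-]]; rewrite -setXI.
  exists (A `&` A'); first exact: measurableI.
  by exists (B `&` B') => //; exact: measurableI.
- by move=> _; exists setT => //; exists setT => //; rewrite setXTT.
- by rewrite bigcup_const.
- move=> _ [A mA [B mB <-]]; transitivity (P E * (m1 \x m2) (A `*` B))%E.
    by rewrite product_measure1E// muleC -UVE.
  by rewrite [in LHS]PE.
- by move=> _; rewrite /= /pushforward /mrestr preimage_setT setTI PE ltry.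
Qed.

Lemma is_mean_law (U : T -> T1) (f : T1 -> R) (r : R) :
  measurable_fun setT U -> (forall C, measurable C -> P (U @^-1` C) = m1 C) ->
  measurable_fun setT f -> (forall x, 0 <= f x) ->
  is_mean P (fun w => f (U w)) r <-> is_mean m1 f r.
Proof.
move=> mU PU mf f0.
have mfU : measurable_fun setT (fun w => f (U w)) by exact: measurableT_comp.
have EfU : (\int[P]_w (f (U w))%:E = \int[m1]_x (f x)%:E)%E.
  transitivity (\int[pushforward P U]_x (f x)%:E)%E.
    rewrite ge0_integral_pushforward//; first exact/measurable_EFinP.
    by move=> x _; rewrite lee_fin.
  by apply: eq_measure_integral => C mC _; exact: PU.
split=> /is_mean_integral E; apply: ge0_is_mean => //.
  by rewrite -EfU.
by rewrite EfU.
Qed.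

Lemma is_mean_indep (f : T1 -> R) (g : T2 -> R) (a b : R) :
  measurable_fun setT f -> measurable_fun setT g ->
  (forall x, 0 <= f x) -> (forall x, 0 <= g x) ->
  is_mean m1 f a -> is_mean m2 g b ->
  is_mean (m1 \x m2)%E (fun p => f p.1 * g p.2) (a * b).
Proof.
move=> mf mg f0 g0 /is_mean_integral fa /is_mean_integral gb.
have mfg : measurable_fun setT (fun p : T1 * T2 => f p.1 * g p.2).
  by apply: measurable_funM; apply: measurableT_comp.
apply: ge0_is_mean => // [p|]; first by rewrite mulr_ge0.
rewrite fubini_tonelli1/=; last 2 first.
- exact/measurable_EFinP.
- by move=> p; rewrite lee_fin mulr_ge0.
have b0 : 0 <= b.
  by rewrite -lee_fin -gb; apply: integral_ge0 => y _; rewrite lee_fin.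
transitivity (\int[m1]_x ((f x)%:E * b%:E))%E.
  apply: eq_integral => x _; rewrite /fubini_F /= -gb -ge0_integralZl//.
  + exact/measurable_EFinP.
  + by move=> y _; rewrite lee_fin.
  + by rewrite lee_fin.
rewrite ge0_integralZr// ?fa//; first exact/measurable_EFinP.
by move=> x _; rewrite lee_fin.
Qed.

End law.

(** * Permutation averages and counting of overlapping pairs *)

Section sums.
Context (R : realType) (n : nat).
Implicit Types (x : 'I_n -> R) (F : 'I_n -> 'I_n -> R).

Lemma sum_delta (I : finType) (f : I -> R) i :
  \sum_j (i == j)%:R * f j = f i.
Proof.
rewrite (bigD1 i)//= eqxx mul1r big1 ?addr0// => j ji.
by rewrite eq_sym (negPf ji) mul0r.
Qed.

Lemma sum_neq (i : 'I_n) : \sum_j (i != j)%:R = n%:R - 1 :> R.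
Proof.
under eq_bigr => j _.
  have -> : (i != j)%:R = 1 - (i == j)%:R * 1 :> R.
    by case: eqP; rewrite /= ?mulr1 ?subrr ?subr0.
  over.
by rewrite sumrB sum_delta sumr_const card_ord.
Qed.

Lemma sum_off_diag F :
  \sum_(p : 'I_n * 'I_n | p.1 != p.2) F p.1 p.2 =
  \sum_i \sum_j (i != j)%:R * F i j.
Proof.
rewrite -(pair_big_dep xpredT (fun i j => i != j) F)/=.
apply: eq_bigr => i _; rewrite big_mkcond; apply: eq_bigr => j _.
by case: ifP; rewrite ?mul1r ?mul0r.
Qed.

Lemma sum_off_diag1 :
  \sum_(p : 'I_n * 'I_n | p.1 != p.2) 1 = n%:R * (n%:R - 1) :> R.
Proof.
rewrite (sum_off_diag (fun _ _ => 1)).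
transitivity (\sum_(i < n) (n%:R - 1) : R); last first.
  by rewrite sumr_const card_ord mulr_natl.
apply: eq_bigr => i _; rewrite -(sum_neq i).
by apply: eq_bigr => j _; rewrite mulr1.
Qed.

Lemma perm_2transitive (t u a b : 'I_n) : t != u -> a != b ->
  exists g : {perm 'I_n}, g t = a /\ g u = b.
Proof.
move=> tu ab; exists (tperm t a * tperm (tperm t a u) b)%g.
rewrite !permM tpermL tpermL; split=> //.
(* The second transposition must fix [a]: [a] differs from [b], and from the image of [u] because
   [tperm t a] is injective and sends [t] to [a]. *)
apply: tpermD; last by rewrite eq_sym.
by rewrite -{2}(tpermL t a) (inj_eq perm_inj) eq_sym.
Qed.

(** Double counting over a permutation [s] and an off-diagonal pair [p]. For fixed [p], left
    translation by some [g] taking (t, u) to [p] turns the left-hand sum into the sum over [s] of F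
    (s p.1) (s p.2). For fixed [s], the map induced by [s] merely permutes the off-diagonal
    pairs. *)
Lemma sum_perm_pair F (t u : 'I_n) : t != u ->
  n%:R * (n%:R - 1) * \sum_(s : {perm 'I_n}) F (s t) (s u) =
  n`!%:R * \sum_(p : 'I_n * 'I_n | p.1 != p.2) F p.1 p.2.
Proof.
move=> tu; rewrite -sum_off_diag1 mulr_suml.
under eq_bigr => p pq.
  have [g [gt gu]] := perm_2transitive tu pq.
  rewrite mul1r (reindex_inj (mulgI g))/=.
  under eq_bigr do rewrite !permM gt gu.
  over.
rewrite exchange_big/=.
under eq_bigr => s _.
  have -> : \sum_(p : 'I_n * 'I_n | p.1 != p.2) F (s p.1) (s p.2) =
      \sum_(p : 'I_n * 'I_n | p.1 != p.2) F p.1 p.2.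
    rewrite [RHS](reindex (fun p : 'I_n * 'I_n => (s p.1, s p.2)))/=.
      by apply: eq_bigl => p; rewrite (inj_eq perm_inj).
    exists (fun p => (s^-1 p.1, s^-1 p.2)%g) => -[i j] _ /=.
      by rewrite !permK.
    by rewrite !permKV.
  over.
by rewrite sumr_const card_Sn mulr_natl.
Qed.

(** Ordered pairs absorb the factor 2 and form the set on which permutations act transitively, over
    which covariances are also summed. *)
Lemma GMD_off_diag x : GMD x = (n%:R * (n%:R - 1))^-1 *
  \sum_(p : 'I_n * 'I_n | p.1 != p.2) `|x p.1 - x p.2|.
Proof.
rewrite (sum_off_diag (fun i j => `|x i - x j|)) /GMD.
have lt_sum : \sum_(i < n) \sum_(j < n | (i < j)%N) `|x i - x j| =
    \sum_(i < n) \sum_(j < n) ((i < j)%N)%:R * `|x i - x j|.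
  apply: eq_bigr => i _; rewrite big_mkcond; apply: eq_bigr => j _.
  by case: ifP; rewrite ?mul1r ?mul0r.
have gt_sum : \sum_(i < n) \sum_(j < n | (i < j)%N) `|x i - x j| =
    \sum_(i < n) \sum_(j < n) ((j < i)%N)%:R * `|x i - x j|.
  rewrite lt_sum exchange_big; apply: eq_bigr => i _; apply: eq_bigr => j _.
  by rewrite distrC.
have -> : \sum_i \sum_j (i != j)%:R * `|x i - x j| =
    2 * \sum_(i < n) \sum_(j < n | (i < j)%N) `|x i - x j|.
  rewrite mulr_natl mulr2n {1}lt_sum gt_sum -big_split/=; apply: eq_bigr => i _.
  rewrite -big_split/=; apply: eq_bigr => j _; rewrite -mulrDl; congr (_ * _).
  rewrite -val_eqE/=; case: ltngtP => _; rewrite ?addr0 ?add0r//.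
by rewrite mulrA [2 / _]mulrC.
Qed.

Lemma sum_ord_pos : (0 < n)%N -> \sum_(t < n | (0 < t)%N) 1 = n%:R - 1 :> R.
Proof.
move=> n0; rewrite sumr_const -(natrB R n0); congr (_%:R).
case: n n0 => // m _; rewrite subn1/=.
have -> : #|[pred t : 'I_m.+1 | (0 < t)%N]| = #|predC1 (@ord0 m)|.
  by apply: eq_card => t; rewrite !inE -val_eqE/= lt0n.
by rewrite cardC1 card_ord.
Qed.

Lemma val_ord_pred (t : 'I_n) : (0 < t)%N -> ord_pred t = t.-1 :> nat.
Proof.
case: t => -[//|t] tn _ /=.
by rewrite modnDr modn_small// ltnW.
Qed.

Lemma ord_pred_eq (t u : 'I_n) : (0 < t)%N ->
  (u == ord_pred t) = (u.+1 == t :> nat).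
Proof.
move=> t0; rewrite -(inj_eq val_inj) [val (ord_pred t)]val_ord_pred//.
by rewrite -eqSS prednK.
Qed.

Lemma avg_MR x : (2 <= n)%N ->
  (n`!)%:R^-1 * \sum_(s : {perm 'I_n}) MR x s = GMD x.
Proof.
move=> n2; have n0 : (0 < n)%N by exact: ltn_trans n2.
have N0 : n%:R != 0 :> R by rewrite pnatr_eq0 -lt0n.
have N1 : n%:R - 1 != 0 :> R by rewrite subr_eq0 pnatr_eq1 gtn_eqF.
have F0 : n`!%:R != 0 :> R by rewrite pnatr_eq0 -lt0n fact_gt0.
rewrite /MR -mulr_sumr exchange_big GMD_off_diag/=; set S := \sum_(p : 'I_n * 'I_n | _) _.
transitivity (n`!%:R^-1 * ((n%:R - 1)^-1 * \sum_(t < n | (0 < t)%N)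
    ((n%:R * (n%:R - 1))^-1 * (n`!%:R * S)))).
  congr (_ * (_ * _)); apply: eq_bigr => t t0.
  have tt : t != ord_pred t by rewrite ord_pred_eq// gtn_eqF.
  have /= <- := sum_perm_pair (fun i j => `|x i - x j|) tt.
  by rewrite mulKf// mulf_neq0.
under eq_bigr do rewrite -[_^-1 * _]mul1r.
rewrite -mulr_suml sum_ord_pos//; field.
by rewrite N0 N1 F0.
Qed.

Lemma sum_delta_cond (I : finType) (Q : pred I) i :
  \sum_(j | Q j) (i == j)%:R = (Q i)%:R :> R.
Proof.
rewrite big_mkcond -[RHS](sum_delta (fun j => (Q j)%:R)).
by apply: eq_bigr => j _; case: (Q j); rewrite ?mulr1 ?mulr0.
Qed.

(* For i != j and k != l this is z2, z1 or 0 according as {i, j} and {k, l} share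
   two, one or no index: two shared indices contribute 2 to the first bracket,
   which the coefficient z2 - 2 * z1 corrects. *)
Definition pair_cov (z1 z2 : R) (i j k l : 'I_n) : R :=
  z1 * ((i == k)%:R + (i == l)%:R + (j == k)%:R + (j == l)%:R) +
  (z2 - 2 * z1) * ((i == k)%:R * (j == l)%:R + (i == l)%:R * (j == k)%:R).

(** Each of the four single coincidences holds for n - 1 off-diagonal pairs, and each of the two
    double coincidences for exactly one, which gives 4(n - 1) z1 + 2(z2 - 2 z1). *)
Lemma pair_cov_sum_off_diag z1 z2 (i j : 'I_n) : i != j ->
  \sum_(q : 'I_n * 'I_n | q.1 != q.2) pair_cov z1 z2 i j q.1 q.2 =
  2 * (z2 + 2 * (n%:R - 2) * z1).
Proof.
move=> ij; rewrite /pair_cov big_split/= -!mulr_sumr !big_split/=.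
have fst_sum a : \sum_(q : 'I_n * 'I_n | q.1 != q.2) (a == q.1)%:R = n%:R - 1 :> R.
  rewrite (sum_off_diag (fun k _ => (a == k)%:R)).
  under eq_bigr do rewrite -mulr_suml mulrC.
  by rewrite sum_delta sum_neq.
have snd_sum a : \sum_(q : 'I_n * 'I_n | q.1 != q.2) (a == q.2)%:R = n%:R - 1 :> R.
  rewrite (sum_off_diag (fun _ l => (a == l)%:R)).
  rewrite exchange_big/=; under eq_bigr do rewrite -mulr_suml mulrC.
  by rewrite sum_delta; under eq_bigr do rewrite eq_sym; exact: sum_neq.
have prod_sum a b : a != b ->
    \sum_(q : 'I_n * 'I_n | q.1 != q.2) ((a == q.1)%:R * (b == q.2)%:R) = 1 :> R.
  move=> ab; under eq_bigr do rewrite -natrM mulnb.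
  by rewrite (sum_delta_cond _ (a, b))/= ab.
rewrite !fst_sum !snd_sum prod_sum//.
under eq_bigr do rewrite mulrC.
rewrite prod_sum; last by rewrite eq_sym.
ring.
Qed.

(** Injectivity of [s] reduces coincidences of values to coincidences of positions: equal positions,
    n - 1 times, contribute z2, and adjacent ones, n - 2 times in each direction, contribute z1. *)
Lemma pair_cov_sum_consecutive z1 z2 (s : {perm 'I_n}) : (2 <= n)%N ->
  \sum_(t < n | (0 < t)%N) \sum_(u < n | (0 < u)%N)
    pair_cov z1 z2 (s t) (s (ord_pred t)) (s u) (s (ord_pred u)) =
  (n%:R - 1) * z2 + 2 * (n%:R - 2) * z1.
Proof.
move=> n2; have n0 : (0 < n)%N by exact: ltn_trans n2.
have pcE (t u : 'I_n) : (0 < t)%N -> (0 < u)%N ->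
    pair_cov z1 z2 (s t) (s (ord_pred t)) (s u) (s (ord_pred u)) =
    z2 * (t == u)%:R + z1 * ((ord_pred t == u)%:R + (ord_pred u == t)%:R).
  move=> t0 u0; rewrite /pair_cov !(inj_eq perm_inj) (inj_eq (@ord_pred_inj n)).
  rewrite [t == ord_pred u]eq_sym.
  (* A crossed double overlap would require t = u - 1 and u = t - 1 at once. *)
  have -> : (ord_pred u == t)%:R * (ord_pred t == u)%:R = 0 :> R.
    rewrite [_ == t]eq_sym [_ == u]eq_sym !ord_pred_eq//.
    by case: eqP => [<-|]; rewrite ?mul0r// -[_.+2]addn2 gtn_eqF ?mulr0// addn2.
  by case: (t == u) => /=; ring.
have pred_sum : \sum_(t < n | (0 < t)%N) \sum_(u < n | (0 < u)%N)
    (ord_pred t == u)%:R = n%:R - 2 :> R.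
  (* [Ordinal n2] is position 1, whose predecessor 0 lies outside the range of [u]; this lost term
     turns n - 1 into n - 2. *)
  transitivity (\sum_(t < n | (0 < t)%N) (1 - (Ordinal n2 == t)%:R) : R).
    apply: eq_bigr => t t0; rewrite (sum_delta_cond (fun u : 'I_n => (0 < u)%N)).
    rewrite val_ord_pred// -val_eqE/=.
    by case: (nat_of_ord t) t0 => [//|[|m]] _; rewrite ?subrr ?subr0.
  by rewrite sumrB sum_ord_pos// sum_delta_cond/=; ring.
under eq_bigr => t t0 do under eq_bigr => u u0 do rewrite pcE//.
under eq_bigr => t t0 do rewrite big_split/= -!mulr_sumr big_split/=.
rewrite big_split/= -!mulr_sumr big_split/=.
have combine a b c : a = n%:R - 1 -> b = n%:R - 2 -> c = n%:R - 2 ->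
    z2 * a + z1 * (b + c) = (n%:R - 1) * z2 + 2 * (n%:R - 2) * z1.
  by move=> -> -> ->; ring.
apply: combine => //; last by rewrite exchange_big.
rewrite -sum_ord_pos//; apply: eq_bigr => t t0.
by rewrite (sum_delta_cond (fun u : 'I_n => (0 < u)%N)) t0.
Qed.

End sums.

(** * Joint laws of two, three and four distinct coordinates *)

Section iid.
Context d (T : measurableType d) (R : realType) (P : probability T R) (n : nat).
Variables (mu : probability R R) (X : 'I_n -> {RV P >-> R}).
Hypothesis Xind : mutually_independent X.
Hypothesis Xlaw : forall i, has_law (X i) mu.

Lemma iid_bigcap (s : seq 'I_n) (F : 'I_n -> set R) : uniq s ->
  (forall i, measurable (F i)) ->
  P (\big[setI/setT]_(i <- s) (X i @^-1` F i)) = (\prod_(i <- s) mu (F i))%E.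
Proof.
move=> us mF; rewrite -bigcap_seq.
have -> : [set` s] = [set` [set x in s]%SET].
  by apply/seteqP; split=> x /=; rewrite inE.
rewrite Xind// (big_uniq _ us)/=.
under eq_bigl do rewrite inE.
by rewrite [LHS](eq_bigr (fun i => mu (F i)))// => i _; exact: (Xlaw i (mF i)).
Qed.

Let mX i : measurable_fun setT (X i). Proof. exact: measurable_funPT. Qed.

Let mXV i A : measurable A -> measurable (X i @^-1` A).
Proof. by move=> mA; rewrite -[X in measurable X]setTI; exact: mX. Qed.

Let mXX i j : measurable_fun setT (fun w => (X i w, X j w)).
Proof. exact: measurable_fun_pair. Qed.

Let mXXV i j C : measurable C -> measurable ((fun w => (X i w, X j w)) @^-1` C).
Proof. by move=> mC; rewrite -[X in measurable X]setTI; exact: mXX. Qed.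

Lemma iid2_indep i j A B : i != j -> measurable A -> measurable B ->
  P (X i @^-1` A `&` X j @^-1` B) = (mu A * mu B)%E.
Proof.
(* Independence asks for a set at every index; the intersection runs over [[:: i; j]] only, so the
   values of [F] elsewhere are arbitrary. *)
move=> ij mA mB; pose F t := if t == i then A else B.
have mF t : measurable (F t) by rewrite /F; case: ifP.
have Fi : F i = A by rewrite /F eqxx.
have Fj : F j = B by rewrite /F eq_sym (negPf ij).
have u : uniq [:: i; j] by rewrite /= inE ij.
by have := iid_bigcap u mF; rewrite !big_cons !big_nil setIT mule1 Fi Fj.
Qed.

Lemma iid3_indep i j k A B C : uniq [:: i; j; k] ->
  measurable A -> measurable B -> measurable C ->
  P (X i @^-1` A `&` X j @^-1` B `&` X k @^-1` C) = (mu A * mu B * mu C)%E.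
Proof.
move=> u mA mB mC; have := u; rewrite /= !inE andbT => /andP[/norP[ij ik] jk].
pose F t := if t == i then A else if t == j then B else C.
have mF t : measurable (F t) by rewrite /F; do 2 case: ifP => // _.
have Fi : F i = A by rewrite /F eqxx.
have Fj : F j = B by rewrite /F eq_sym (negPf ij) eqxx.
have Fk : F k = C by rewrite /F [k == i]eq_sym (negPf ik) [k == j]eq_sym (negPf jk).
have := iid_bigcap u mF.
by rewrite !big_cons !big_nil setIT mule1 Fi Fj Fk setIA muleA.
Qed.

Lemma iid4_indep i j k l A B C D : uniq [:: i; j; k; l] ->
  measurable A -> measurable B -> measurable C -> measurable D ->
  P (X i @^-1` A `&` X j @^-1` B `&` (X k @^-1` C `&` X l @^-1` D)) =
  (mu A * mu B * (mu C * mu D))%E.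
Proof.
move=> u mA mB mC mD; have := u; rewrite /= !inE andbT.
move=> /andP[/norP[ij /norP[ik il]] /andP[/norP[jk jl] kl]].
pose F t := if t == i then A else if t == j then B else if t == k then C else D.
have mF t : measurable (F t) by rewrite /F; do 3 case: ifP => // _.
have Fi : F i = A by rewrite /F eqxx.
have Fj : F j = B by rewrite /F eq_sym (negPf ij) eqxx.
have Fk : F k = C.
  by rewrite /F [k == i]eq_sym (negPf ik) [k == j]eq_sym (negPf jk) eqxx.
have Fl : F l = D.
  rewrite /F [l == i]eq_sym (negPf il) [l == j]eq_sym (negPf jl).
  by rewrite [l == k]eq_sym (negPf kl).
have := iid_bigcap u mF.
by rewrite !big_cons !big_nil setIT mule1 Fi Fj Fk Fl setIA muleA.
Qed.

Lemma law_X2 i j C : i != j -> measurable C ->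
  P ((fun w => (X i w, X j w)) @^-1` C) = (mu \x mu)%E C.
Proof.
move=> ij mC; have := @pair_law _ _ _ T R R R P mu mu (X i) (X j) setT.
move=> /(_ (mX i) (mX j) measurableT) H.
rewrite -(setIT (_ @^-1` C)) H// ?probability_setT ?mule1// => A B mA mB.
by rewrite setIT mule1 iid2_indep.
Qed.

Lemma law_X3 i j k C : uniq [:: i; j; k] -> measurable C ->
  P ((fun w => ((X i w, X j w), X k w)) @^-1` C) = iid3 mu C.
Proof.
move=> u mC.
have := @pair_law _ _ _ T (R * R)%type R R P (mu \x mu)%E mu
  (fun w => (X i w, X j w)) (X k) setT.
move=> /(_ (mXX i j) (mX k) measurableT) H.
rewrite -(setIT (_ @^-1` C)) H// ?probability_setT ?mule1// => A B mA mB.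
rewrite setIT mule1.
have PB : P (X k @^-1` B) = mu B by exact: (Xlaw k mB).
(* Here [A] is an arbitrary planar set; a second use of [pair_law], with [E] the event that X k lies
   in [B], reduces it to rectangles, where [iid3_indep] applies. *)
rewrite (@pair_law _ _ _ T R R R P mu mu (X i) (X j))//; last 2 first.
- exact: mXV.
- by move=> A' B' mA' mB'; rewrite iid3_indep// PB.
by rewrite PB.
Qed.

Lemma law_X4 i j k l C : uniq [:: i; j; k; l] -> measurable C ->
  P ((fun w => ((X i w, X j w), (X k w, X l w))) @^-1` C) =
  ((mu \x mu) \x (mu \x mu))%E C.
Proof.
move=> u mC.
have [ij kl] : i != j /\ k != l.
  move: u; rewrite /= !inE andbT.
  by move=> /andP[/norP[ij /norP[ik il]] /andP[/norP[jk jl] kl]].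
have := @pair_law _ _ _ T (R * R)%type (R * R)%type R P (mu \x mu)%E (mu \x mu)%E
  (fun w => (X i w, X j w)) (fun w => (X k w, X l w)) setT.
move=> /(_ (mXX i j) (mXX k l) measurableT) H.
rewrite -(setIT (_ @^-1` C)) H// ?probability_setT ?mule1// => A B mA mB.
rewrite setIT mule1 setIC muleC.
have PA : P ((fun w => (X i w, X j w)) @^-1` A) = (mu \x mu)%E A.
  exact: law_X2.
(* The planar sets are reduced to rectangles one at a time: [B] here, with [E] the event that (X i,
   X j) lies in [A], and then [A], with [E] the rectangle event for (X k, X l). *)
rewrite (@pair_law _ _ _ T R R R P mu mu (X k) (X l))//; last 2 first.
- exact: mXXV.
- move=> A1 B1 mA1 mB1; rewrite setIC.
  rewrite (@pair_law _ _ _ T R R R P mu mu (X i) (X j))//; last 2 first.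
  + by apply: measurableI; exact: mXV.
  + by move=> A2 B2 mA2 mB2; rewrite iid4_indep// iid2_indep.
  by rewrite iid2_indep// muleC PA.
by rewrite PA.
Qed.

End iid.

(** * Moments of pair distances and finiteness of the zetas *)

Section iid.
Context d (T : measurableType d) (R : realType) (P : probability T R) (n : nat).
Variables (mu : probability R R) (X : 'I_n -> {RV P >-> R}).
Hypothesis Xind : mutually_independent X.
Hypothesis Xlaw : forall i, has_law (X i) mu.

Hypothesis Xvar : forall i, ('V_P[X i] < +oo)%E.

Let mX i : measurable_fun setT (X i). Proof. exact: measurable_funPT. Qed.

Let mXX i j : measurable_fun setT (fun w => (X i w, X j w)).
Proof. exact: measurable_fun_pair. Qed.

Let dist (p : R * R) : R := `|p.1 - p.2|.

Let mdist : measurable_fun setT dist.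
Proof. by apply: measurableT_comp => //; apply: measurable_funB. Qed.

Let mD12 : measurable_fun setT (@D12 R).
Proof. exact: (measurableT_comp mdist measurable_fst). Qed.

Let mD13 : measurable_fun setT (@D13 R).
Proof.
have m13 : measurable_fun setT (fun p : R * R * R => (p.1.1, p.2)).
  by apply: measurable_fun_pair => //; exact: measurableT_comp.
exact: (measurableT_comp mdist m13).
Qed.

Let sqrdist (p : R * R) : R := dist p ^+ 2.

Let msqrdist : measurable_fun setT sqrdist.
Proof. exact: measurable_funX. Qed.

Lemma iid3_setX (C : set (R * R)) (A : set R) : measurable C -> measurable A ->
  iid3 mu (C `*` A) = ((mu \x mu) C * mu A)%E.
Proof. by move=> mC mA; exact: product_measure1E. Qed.

Lemma D12_law (f : R * R -> R) r :
  measurable_fun setT f -> (forall p, 0 <= f p) ->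
  is_mean (iid3 mu) (fun p => f p.1) r <-> is_mean (mu \x mu)%E f r.
Proof.
move=> mf f0; apply: is_mean_law => // C mC.
have -> : fst @^-1` C = C `*` [set: R] by rewrite setXT.
by rewrite iid3_setX// probability_setT mule1.
Qed.

(** Dropping the middle coordinate of [iid3] leaves the law [mu \x mu], as cylinders show; hence
    [D13] has the same moments as [D12]. *)
Lemma D13_law (f : R * R -> R) r :
  measurable_fun setT f -> (forall p, 0 <= f p) ->
  is_mean (iid3 mu) (fun p => f (p.1.1, p.2)) r <-> is_mean (mu \x mu)%E f r.
Proof.
move=> mf f0; apply: (is_mean_law _ _ (U := fun p => (p.1.1, p.2))) => //.
  by apply: measurable_fun_pair => //; exact: measurableT_comp.
move=> C mC.
have := @pair_law _ _ _ _ R R R (iid3 mu) mu mu (fun p => p.1.1) snd setT.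
rewrite -(setIT (_ @^-1` C)) => ->//; rewrite ?probability_setT ?mule1//.
  exact: measurableT_comp.
move=> A B mA mB; rewrite setIT mule1.
have -> : (fun p : R * R * R => p.1.1) @^-1` A `&` snd @^-1` B =
    (A `*` [set: R]) `*` B.
  by apply/seteqP; split => [[[? ?] ?]|[[? ?] ?]] /= []// [].
rewrite iid3_setX//; last exact: measurableX.
have mu1 : mu [set: R] = 1%E by exact: probability_setT.
have -> : (mu \x mu)%E (A `*` [set: R]) = mu A; last by [].
by rewrite product_measure1E// [X in (_ * X)%E]probability_setT mule1.
Qed.

Lemma absB_Lfun2 i j : (fun w => `|X i w - X j w|) \in Lfun P 2%:E.
Proof.
have mXB : measurable_fun setT (fun w => X i w - X j w).
  exact: measurable_funB.
have XB2 : (fun w => X i w - X j w) \in Lfun P 2%:E.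
  by apply: rpredB; rewrite ?lee1n// => ?; exact: Lfun2_variance.
apply: Lfun2_sqr_integrable; first exact: measurableT_comp.
under eq_fun do rewrite real_normK ?num_real//.
exact: Lfun2_integrable_sqr.
Qed.

(** Square integrability is known under [P] and wanted under [iid3]. It passes to [mu \x mu] through
    the law of one pair of distinct coordinates, then to [iid3] through its two marginals; [D12]
    times [D13] is integrable as a product of L2 functions, which also covers n = 2. *)
Lemma dist_moments (i j : 'I_n) : i != j -> exists m q1 q2,
  [/\ is_mean (mu \x mu)%E dist m, is_mean (mu \x mu)%E sqrdist q2 &
      is_mean (iid3 mu) (fun p => D12 p * D13 p) q1].
Proof.
move=> ij.
have sd0 p : 0 <= sqrdist p by exact: sqr_ge0.
have Yq : is_mean P (fun w => `|X i w - X j w| ^+ 2)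
    (fine 'E_P[(fun w => `|X i w - X j w| ^+ 2)%R]%E).
  split; last first.
    rewrite fineK// expectation_fin_num//.
    exact/Lfun1_integrable/Lfun2_integrable_sqr/absB_Lfun2.
  exact/Lfun1_integrable/Lfun2_integrable_sqr/absB_Lfun2.
set q2 := fine _ in Yq.
have sq : is_mean (mu \x mu)%E sqrdist q2.
  have law C := @law_X2 _ _ _ _ _ _ _ Xind Xlaw i j C ij.
  exact: (is_mean_law q2 (mXX i j) law msqrdist sd0).1.
have [D12q _] := (D12_law q2 msqrdist sd0).2 sq.
have [D13q _] := (D13_law q2 msqrdist sd0).2 sq.
have D12_2 : @D12 R \in Lfun (iid3 mu) 2%:E.
  by apply: Lfun2_sqr_integrable => //; exact/Lfun1_integrable.
have D13_2 : @D13 R \in Lfun (iid3 mu) 2%:E.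
  by apply: Lfun2_sqr_integrable => //; exact/Lfun1_integrable.
have D12_1 : @D12 R \in Lfun (iid3 mu) 1.
  by apply: Lfun_subset12 => //; rewrite fin_num_measure.
have D1213 : (fun p => D12 p * D13 p) \in Lfun (iid3 mu) 1.
  exact: (Lfun2_mul_Lfun1 D12_2 D13_2).
exists (fine 'E_(iid3 mu)[@D12 R]%E).
exists (fine 'E_(iid3 mu)[(fun p => D12 p * D13 p)%R]%E), q2; split => //.
- apply/(D12_law _ mdist) => //; first by move=> p; exact: normr_ge0.
  by split=> //; rewrite fineK// expectation_fin_num.
- by split=> //; rewrite fineK// expectation_fin_num.
Qed.

Lemma iid_moments : (2 <= n)%N -> exists m z1 z2 : R,
  [/\ zeta1 mu = z1%:E, zeta2 mu = z2%:E,
     forall i j : 'I_n, i != j -> is_mean P (fun w => `|X i w - X j w|) m &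
     forall i j k l : 'I_n, i != j -> k != l ->
       is_mean P (fun w => `|X i w - X j w| * `|X k w - X l w|)
         (m ^+ 2 + pair_cov z1 z2 i j k l)].
Proof.
move=> n2; have n0 : (0 < n)%N by exact: ltn_trans n2.
have : Ordinal n0 != Ordinal n2 by [].
move=> /dist_moments[m [q1 [q2 [dm sq dq]]]].
have d0 p : 0 <= dist p by exact: normr_ge0.
have sd0 p : 0 <= sqrdist p by exact: sqr_ge0.
have D12m := (D12_law m mdist d0).2 dm.
have D13m := (D13_law m mdist d0).2 dm.
have D12q := (D12_law q2 msqrdist sd0).2 sq.
have E2 i j : i != j -> is_mean P (fun w => `|X i w - X j w|) m.
  move=> ij; have law C := @law_X2 _ _ _ _ _ _ _ Xind Xlaw i j C ij.
  exact: (is_mean_law m (mXX i j) law mdist d0).2.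
have E22 i j : i != j ->
    is_mean P (fun w => `|X i w - X j w| * `|X i w - X j w|) q2.
  move=> ij; have law C := @law_X2 _ _ _ _ _ _ _ Xind Xlaw i j C ij.
  exact: (is_mean_law q2 (mXX i j) law msqrdist sd0).2.
have E3 i j k : i != j -> i != k -> j != k ->
    is_mean P (fun w => `|X i w - X j w| * `|X i w - X k w|) q1.
  move=> ij ik jk.
  have u : uniq [:: i; j; k] by rewrite /= !inE negb_or ij ik jk.
  have mXXX : measurable_fun setT (fun w => (X i w, X j w, X k w)).
    exact: measurable_fun_pair.
  have D0 p : 0 <= @D12 R p * D13 p by rewrite mulr_ge0// normr_ge0.
  have mD : measurable_fun setT (fun p => @D12 R p * D13 p).
    exact: measurable_funM.
  have law C := @law_X3 _ _ _ _ _ _ _ Xind Xlaw i j k C u.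
  exact: (is_mean_law q1 mXXX law mD D0).2.
have E4 i j k l : uniq [:: i; j; k; l] ->
    is_mean P (fun w => `|X i w - X j w| * `|X k w - X l w|) (m ^+ 2).
  move=> u.
  have mX4 : measurable_fun setT (fun w => ((X i w, X j w), (X k w, X l w))).
    exact: measurable_fun_pair.
  have D0 p : 0 <= dist p.1 * dist p.2 by rewrite mulr_ge0.
  have mD : measurable_fun setT (fun p => dist p.1 * dist p.2).
    by apply: measurable_funM; exact: measurableT_comp.
  have law C := @law_X4 _ _ _ _ _ _ _ Xind Xlaw i j k l C u.
  apply: (is_mean_law (m ^+ 2) mX4 law mD D0).2.
  exact: is_mean_indep.
exists m, (q1 - m ^+ 2), (q2 - m ^+ 2); split => //.
- exact: is_mean_covariance.
- exact: is_mean_variance.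
(* Swapping the ends of a distance brings a shared index to the front of both, the form handled by
   [E22] and [E3]. *)
have C w i j : `|X i w - X j w| = `|X j w - X i w| by exact: distrC.
move=> i j k l ij kl; rewrite /pair_cov; have ji : j != i by rewrite eq_sym.
have [ik|ik] := eqVneq i k; first subst k.
  rewrite (negPf kl) [j == i]eq_sym (negPf ij).
  have [jl|jl] := eqVneq j l; first subst l.
    by have := E22 _ _ ij; congr is_mean; rewrite /=; ring.
  by have := E3 _ _ _ ij kl jl; congr is_mean; rewrite /=; ring.
have [il|il] := eqVneq i l; first subst l.
  rewrite [j == i]eq_sym (negPf ij).
  under eq_fun do rewrite [X in _ * X]C.
  have [jk|jk] := eqVneq j k; first subst k.
    by have := E22 _ _ ij; congr is_mean; rewrite /=; ring.
  by have := E3 _ _ _ ij ik jk; congr is_mean; rewrite /=; ring.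
have [jk|jk] := eqVneq j k; first subst k.
  rewrite (negPf kl).
  under eq_fun do rewrite [X in X * _]C.
  by have := E3 j i l ji kl il; congr is_mean; rewrite /=; ring.
have [jl|jl] := eqVneq j l; first subst l.
  under eq_fun do rewrite [X in X * _]C [X in _ * X]C.
  by have := E3 j i k ji jk ik; congr is_mean; rewrite /=; ring.
have u : uniq [:: i; j; k; l] by rewrite /= !inE !negb_or ij ik il jk jl kl.
by have := E4 _ _ _ _ u; congr is_mean; rewrite /=; ring.
Qed.

End iid.

(** * Product rule for the mean of independent nonnegative variables *)

Section mul_indep.
Context d (T : measurableType d) (R : realType) (P : probability T R).

Lemma is_mean_mul_indep (Y Z : T -> R) (a b : R) :
  measurable_fun setT Y -> measurable_fun setT Z ->
  (forall w, 0 <= Y w) -> (forall w, 0 <= Z w) ->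
  (forall A B, measurable A -> measurable B ->
    P (Y @^-1` A `&` Z @^-1` B) = (P (Y @^-1` A) * P (Z @^-1` B))%E) ->
  is_mean P Y a -> is_mean P Z b -> is_mean P (fun w => Y w * Z w) (a * b).
Proof.
move=> mY mZ Y0 Z0 YZ Ya Zb.
pose m1 : probability R R := distribution P (mfun_Sub (mem_set mY)).
pose m2 : probability R R := distribution P (mfun_Sub (mem_set mZ)).
(* The norm stands in for the identity, which is not nonnegative on all of R. *)
have mnorm : measurable_fun setT (fun x : R => `|x|) by exact: measurableT_comp.
have norm0 (x : R) : 0 <= `|x| by exact: normr_ge0.
have lawY : is_mean m1 (fun x => `|x|) a.
  apply: (is_mean_law (m1 := m1) a mY _ mnorm norm0).1 => //.
  by under eq_fun do rewrite ger0_norm//.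
have lawZ : is_mean m2 (fun x => `|x|) b.
  apply: (is_mean_law (m1 := m2) b mZ _ mnorm norm0).1 => //.
  by under eq_fun do rewrite ger0_norm//.
have mYZ : measurable_fun setT (fun w => (Y w, Z w)).
  exact: measurable_fun_pair.
have law C : measurable C -> P ((fun w => (Y w, Z w)) @^-1` C) = (m1 \x m2)%E C.
  move=> mC; have := @pair_law _ _ _ _ _ _ _ P m1 m2 Y Z setT mY mZ measurableT.
  rewrite -(setIT (_ @^-1` C)) => ->//; rewrite ?probability_setT ?mule1//.
  by move=> A B mA mB; rewrite setIT mule1; exact: YZ.
have mf : measurable_fun setT (fun p : R * R => `|p.1| * `|p.2|).
  by apply: measurable_funM; exact: measurableT_comp.
have f0 (p : R * R) : 0 <= `|p.1| * `|p.2| by rewrite mulr_ge0.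
have := (is_mean_law (m1 := (m1 \x m2)%E) (a * b) mYZ law mf f0).2
  (is_mean_indep mnorm mnorm norm0 norm0 lawY lawZ).
by under eq_fun do rewrite /= !ger0_norm//.
Qed.

End mul_indep.

(** * Means of functions of the random permutation *)

Section permuted.
Context d (T : measurableType d) (R : realType) (P : probability T R) (n : nat).
Variables (X : 'I_n -> {RV P >-> R}) (Pi : T -> {perm 'I_n}).
Hypotheses (mPi : random_perm Pi) (Piunif : uniform_perm P Pi).
Hypothesis XPi : independent_perm X Pi.

Let Xv (w : T) (i : 'I_n) : R := X i w.

Lemma Pi_indicE s : (fun w => (Pi w == s)%:R) = \1_(Pi @^-1` [set s]) :> (T -> R).
Proof.
apply/funext => w; rewrite indicE; congr (_%:R); congr nat_of_bool.
by apply/idP/idP => [/eqP Pws|/set_mem/= ->//]; exact/mem_set.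
Qed.

Lemma is_mean_Pi_indic s : is_mean P (fun w => (Pi w == s)%:R) (n`!%:R)^-1.
Proof.
apply: ge0_is_mean => //.
  by rewrite Pi_indicE; apply: measurable_indic; exact: mPi.
under eq_integral do rewrite (congr1 (@^~ _) (Pi_indicE s)).
by rewrite integral_indic// setIT; exact: Piunif.
Qed.

(** Resolving a function of [Pi] into indicators of its finitely many values reduces every mean
    involving [Pi] to a finite sum. *)
Lemma sum_Pi (V : {perm 'I_n} -> R) w :
  \sum_s (Pi w == s)%:R * V s = V (Pi w).
Proof. exact: sum_delta. Qed.

Lemma is_mean_comp_Pi (g : {perm 'I_n} -> R) :
  is_mean P (fun w => g (Pi w)) (n`!%:R^-1 * \sum_s g s).
Proof.
under eq_fun do rewrite -sum_Pi.
rewrite mulr_sumr; apply: is_mean_sum => s _.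
rewrite mulrC; under eq_fun do rewrite mulrC.
by apply: is_meanZ; exact: is_mean_Pi_indic.
Qed.

Let XT := g_sigma_algebraType
  (\big[setU/set0]_(i < n) preimage_set_system setT (X i) measurable).

(* Measurability is required for every measurable structure on the domain because
   independence is stated for the sigma-algebra generated by X, not for that of T. *)
Lemma is_mean_independent_perm (h : ('I_n -> R) -> {perm 'I_n} -> R)
    (r : {perm 'I_n} -> R) :
  (forall d' (T' : measurableType d') (Y : 'I_n -> T' -> R) s,
    (forall i, measurable_fun setT (Y i)) ->
    measurable_fun setT (fun w => h (Y ^~ w) s)) ->
  (forall x s, 0 <= h x s) ->
  (forall s, is_mean P (fun w => h (Xv w) s) (r s)) ->
  is_mean P (fun w => h (Xv w) (Pi w)) (n`!%:R^-1 * \sum_s r s).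
Proof.
move=> mh h0 hr.
under eq_fun do rewrite -(sum_Pi (h _)).
rewrite mulr_sumr; apply: is_mean_sum => s _.
rewrite mulrC; under eq_fun do rewrite mulrC.
apply: is_mean_mul_indep => //.
- by apply: mh => i; exact: measurable_funPT.
- by rewrite Pi_indicE; apply: measurable_indic; exact: mPi.
- move=> A B mA mB.
  have -> : (fun w => (Pi w == s)%:R) @^-1` B =
      Pi @^-1` [set t | B (t == s)%:R] by [].
  apply: XPi.
  (* On [XT] every [X i] is measurable by construction, so measurability of h there says exactly
     that its preimage of [A] is an event generated by [X]. *)
  have mX i : measurable_fun [set: XT] (X i : XT -> R).
    move=> _ C mC; apply: sub_sigma_algebra.
    by rewrite (bigD1 i)//=; left; exists C.
  have /(_ measurableT A mA) := mh _ XT (fun i => X i : XT -> R) s mX.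
  by rewrite setTI.
- exact: is_mean_Pi_indic.
Qed.

End permuted.

Lemma measurable_MR d (T : measurableType d) (R : realType) (n : nat)
    (Y : 'I_n -> T -> R) (s : {perm 'I_n}) :
  (forall i, measurable_fun setT (Y i)) ->
  measurable_fun setT (fun w => MR (Y ^~ w) s).
Proof.
move=> mY; apply: measurable_funM => //.
under eq_fun do rewrite big_mkcond; apply: measurable_sum => t.
by case: (0 < t)%N => //; apply: measurableT_comp => //; exact: measurable_funB.
Qed.

(** * First two moments of the statistics and their variances *)

Section moments.
Context d (T : measurableType d) (R : realType) (P : probability T R) (n : nat).
Variables (X : 'I_n -> {RV P >-> R}) (Pi : T -> {perm 'I_n}).
Variables (m z1 z2 : R).
Hypothesis absB_mean : forall i j : 'I_n, i != j ->
  is_mean P (fun w => `|X i w - X j w|) m.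
Hypothesis absB_mul_mean : forall i j k l : 'I_n, i != j -> k != l ->
  is_mean P (fun w => `|X i w - X j w| * `|X k w - X l w|)
    (m ^+ 2 + pair_cov z1 z2 i j k l).

Let Xv (w : T) (i : 'I_n) : R := X i w.

Section pair_sums.
Context (I : finType) (Q : pred I) (u v : I -> 'I_n) (N C : R).
Hypothesis uv : forall p, Q p -> u p != v p.
Hypothesis sumN : \sum_(p | Q p) 1 = N.
Hypothesis sumC :
  \sum_(p | Q p) \sum_(q | Q q) pair_cov z1 z2 (u p) (v p) (u q) (v q) = C.

Let S (w : T) : R := \sum_(p | Q p) `|X (u p) w - X (v p) w|.

Lemma pair_sum_mean : is_mean P S (N * m).
Proof.
rewrite -sumN mulr_suml; apply: is_mean_sum => p Qp.
by rewrite mul1r; exact/absB_mean/uv.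
Qed.

(** Expanding the square of a sum of N distances gives N^2 copies of m^2 plus the total covariance
    [C]. The family of pairs is left abstract so as to serve both consecutive positions and
    off-diagonal pairs. *)
Lemma pair_sum_sqr_mean : is_mean P (fun w => S w ^+ 2) ((N * m) ^+ 2 + C).
Proof.
have -> : (N * m) ^+ 2 + C = \sum_(p | Q p) \sum_(q | Q q)
    (m ^+ 2 + pair_cov z1 z2 (u p) (v p) (u q) (v q)).
  under eq_bigr do rewrite big_split/=.
  rewrite big_split/= sumC; congr (_ + _).
  by rewrite exprMn {1}expr2 -sumN !mulr_suml; apply: eq_bigr => p _;
    rewrite mul1r mulr_suml; apply: eq_bigr => q _; rewrite mul1r.
under eq_fun do rewrite expr2 /S big_distrlr.
apply: is_mean_sum => p Qp; apply: is_mean_sum => q Qq.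
by apply: absB_mul_mean; exact: uv.
Qed.

End pair_sums.

Hypothesis n2 : (2 <= n)%N.

Let N : R := n%:R.

Let N0 : N != 0. Proof. by rewrite pnatr_eq0 -lt0n (ltn_trans _ n2). Qed.

Let N1 : N - 1 != 0. Proof. by rewrite subr_eq0 pnatr_eq1 gtn_eqF. Qed.

Let v1 := ((N - 1) * z2 + 2 * (N - 2) * z1) / (N - 1) ^+ 2.

Let v2 := 2 * (z2 + 2 * (N - 2) * z1) / (N * (N - 1)).

(** Neither moment depends on [s]; this is why randomising the order leaves them unchanged. *)
Lemma MR_mean s : is_mean P (fun w => MR (Xv w) s) m /\
  is_mean P (fun w => MR (Xv w) s ^+ 2) (m ^+ 2 + v1).
Proof.
have uv (t : 'I_n) : (0 < t)%N -> s t != s (ord_pred t).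
  by move=> t0; rewrite (inj_eq perm_inj) ord_pred_eq// gtn_eqF.
have sumN := sum_ord_pos R (ltn_trans (ltnSn 0) n2).
have sumC := pair_cov_sum_consecutive z1 z2 s n2.
split.
  have := is_meanZ (N - 1)^-1 (pair_sum_mean uv sumN).
  by rewrite mulKf.
have := is_meanZ ((N - 1)^-1 ^+ 2) (pair_sum_sqr_mean uv sumN sumC).
under eq_fun do rewrite -exprMn.
by congr is_mean; rewrite /v1 -/N; field.
Qed.

Lemma GMD_mean : is_mean P (fun w => GMD (Xv w)) m /\
  is_mean P (fun w => GMD (Xv w) ^+ 2) (m ^+ 2 + v2).
Proof.
have uv (p : 'I_n * 'I_n) : p.1 != p.2 -> p.1 != p.2 by [].
have sumN := sum_off_diag1 R n.
have sumC : \sum_(p : 'I_n * 'I_n | p.1 != p.2)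
    \sum_(q : 'I_n * 'I_n | q.1 != q.2) pair_cov z1 z2 p.1 p.2 q.1 q.2 =
    N * (N - 1) * (2 * (z2 + 2 * (N - 2) * z1)).
  rewrite -sumN mulr_suml; apply: eq_bigr => p pq.
  by rewrite pair_cov_sum_off_diag// mul1r.
split; under eq_fun do rewrite GMD_off_diag.
  have := is_meanZ (N * (N - 1))^-1 (pair_sum_mean uv sumN).
  by rewrite mulKf// mulf_neq0.
have := is_meanZ ((N * (N - 1))^-1 ^+ 2) (pair_sum_sqr_mean uv sumN sumC).
under eq_fun do rewrite -exprMn.
by congr is_mean; rewrite /v2 -/N; field; rewrite N0 N1.
Qed.

Hypotheses (mPi : random_perm Pi) (Piunif : uniform_perm P Pi).
Hypothesis XPi : independent_perm X Pi.

Variable c : R.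

(** The factor [c] treats the moving range (c = 1) and [Tstat] (c = 1 / d2) together. *)
Let MRc (x : 'I_n -> R) s := MR x s * c.

Let MR_ge0 (x : 'I_n -> R) s : 0 <= MR x s.
Proof.
rewrite mulr_ge0 ?sumr_ge0// invr_ge0 subr_ge0 ler1n.
exact: ltn_trans n2.
Qed.

Lemma avg_cst (a : R) : (n`!)%:R^-1 * \sum_(s : {perm 'I_n}) a = a.
Proof.
by rewrite sumr_const card_Sn -(mulr_natl a) mulKf//.
Qed.

Lemma variance_MR : 'V_P[fun w => MRc (Xv w) (Pi w)]%E = (v1 * c ^+ 2)%:E.
Proof.
have mean1 : is_mean P (fun w => MR (Xv w) (Pi w)) m.
  rewrite -(avg_cst m); apply: is_mean_independent_perm => //.
    by move=> d' T' Y s; exact: measurable_MR.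
  by move=> s; case: (MR_mean s).
have mean2 : is_mean P (fun w => MR (Xv w) (Pi w) ^+ 2) (m ^+ 2 + v1).
  rewrite -(avg_cst (m ^+ 2 + v1)).
  apply: (is_mean_independent_perm _ _ _ (h := fun x s => MR x s ^+ 2)) => //.
  - by move=> d' T' Y s mY; apply: measurable_funX; exact: measurable_MR.
  - by move=> x s; exact: sqr_ge0.
  - by move=> s; case: (MR_mean s).
exact: (is_mean_varianceZ c mean1 mean2).
Qed.

Lemma variance_GMD : 'V_P[(fun w => GMD (Xv w) * c)%R]%E = (v2 * c ^+ 2)%:E.
Proof.
by have [mean1 mean2] := GMD_mean; exact: (is_mean_varianceZ c mean1 mean2).
Qed.

Lemma cond_expectation_MR :
  cond_expectation MRc X Pi = (fun w => GMD (Xv w) * c).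
Proof.
apply/funext => w; rewrite /cond_expectation.
have [_ ->] := is_mean_comp_Pi mPi Piunif (MRc (Xv w)).
by rewrite /= -mulr_suml mulrA avg_MR.
Qed.

Lemma expectation_cond_variance_MR :
  'E_P[cond_variance MRc X Pi]%E = ((v1 - v2) * c ^+ 2)%:E.
Proof.
(* With [X] frozen, this is the second moment over a uniform permutation minus the squared mean, the
   mean being identified by [avg_MR]. *)
have -> : cond_variance MRc X Pi = fun w => c ^+ 2 *
    (n`!%:R^-1 * (\sum_s MR (Xv w) s ^+ 2) - GMD (Xv w) ^+ 2).
  apply/funext => w; rewrite /cond_variance.
  have mean1 := is_mean_comp_Pi mPi Piunif (MRc (Xv w)).
  have mean2 := is_mean_comp_Pi mPi Piunif (fun s => MRc (Xv w) s ^+ 2).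
  rewrite (is_mean_variance mean1 mean2)/= -mulr_suml mulrA avg_MR//.
  under eq_bigr do rewrite exprMn.
  by rewrite -mulr_suml; ring.
have [_ G2] := GMD_mean.
have M2 : is_mean P (fun w => n`!%:R^-1 * \sum_s MR (Xv w) s ^+ 2) (m ^+ 2 + v1).
  rewrite -(avg_cst (m ^+ 2 + v1)); apply/is_meanZ/is_mean_sum => s _.
  by case: (MR_mean s).
have [_ ->] := is_meanZ (c ^+ 2) (is_meanB M2 G2).
by congr EFin; ring.
Qed.

End moments.

Local Open Scope ereal_scope.

Theorem proposition3 (R : realType) (d : measure_display) (T : measurableType d)
    (P : probability T R) (n : nat) (hn : (2 <= n)%N)
    (mu : probability R R)
    (X : 'I_n -> {RV P >-> R}) (Pi : T -> {perm 'I_n})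
    (Xind : mutually_independent X)
    (Xlaw : forall i, has_law (X i) mu)
    (Xvar : forall i, 'V_P[X i] < +oo)
    (mPi : random_perm Pi)
    (Piunif : uniform_perm P Pi)
    (XPi : independent_perm X Pi) :
  let N : R := n%:R%R in
  let z1 := zeta1 mu in
  let z2 := zeta2 mu in
  let v1 := ((N - 1)%:E * z2 + (2 * (N - 2))%:E * z1)
            * (((N - 1) ^+ 2)^-1)%:E in
  let v2 := (2%:E * (z2 + (2 * (N - 2))%:E * z1)) * ((N * (N - 1))^-1)%:E in
  let v3 := ((N - 2) / (N * (N - 1)))%:E
            * (z2 - (2 * (N - 2) / (N - 1))%:E * z1) in
  let Xv := fun (w : T) (i : 'I_n) => X i w in
  [/\ 'V_P[fun w => MR (Xv w) (Pi w)] = v1,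
      'V_P[fun w => GMD (Xv w)] = v2 &
      'E_P[cond_variance (@MR R n) X Pi] = v3] /\
  [/\ 'V_P[fun w => Tstat (Xv w) (Pi w)] = v1 * ((d2 R ^+ 2)^-1)%:E,
      'V_P[cond_expectation (@Tstat R n) X Pi] = v2 * ((d2 R ^+ 2)^-1)%:E &
      'E_P[cond_variance (@Tstat R n) X Pi] = v3 * ((d2 R ^+ 2)^-1)%:E].
Proof.
move=> N z1 z2 v1 v2 v3 Xv.
have [m [r1 [r2 [z1E z2E absB_mean absB_mul_mean]]]] :=
  iid_moments Xind Xlaw Xvar hn.
have varMR := variance_MR absB_mean absB_mul_mean hn mPi Piunif XPi.
have varGMD := variance_GMD absB_mean absB_mul_mean hn.
have condMR := cond_expectation_MR X hn mPi Piunif.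
have varcond := expectation_cond_variance_MR absB_mean absB_mul_mean hn mPi Piunif.
have v1E : v1 = (((N - 1) * r2 + 2 * (N - 2) * r1) / (N - 1) ^+ 2)%R%:E.
  by rewrite /v1 /z1 /z2 z1E z2E.
have v2E : v2 = (2 * (r2 + 2 * (N - 2) * r1) / (N * (N - 1)))%R%:E.
  by rewrite /v2 /z1 /z2 z1E z2E.
(* The claimed closed form is v1 - v2, the between-sample part subtracted from the total
   variance. *)
have v3E : v3 = (((N - 1) * r2 + 2 * (N - 2) * r1) / (N - 1) ^+ 2 -
    2 * (r2 + 2 * (N - 2) * r1) / (N * (N - 1)))%R%:E.
  rewrite /v3 /z1 /z2 z1E z2E; apply: (congr1 EFin).
  have N0 : (N != 0)%R by rewrite pnatr_eq0 -lt0n (ltn_trans _ hn).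
  have N1 : (N - 1 != 0)%R by rewrite subr_eq0 pnatr_eq1 gtn_eqF.
  by field; rewrite N0 N1.
(* For c = 1 the trailing factor has to be removed by rewriting; for c equal to the inverse of
   [d2 R], the scaled moving range is [Tstat] by unfolding. *)
have MR1 : (fun x s => MR x s * 1)%R = @MR R n.
  by apply/funext => x; apply/funext => s; rewrite mulr1.
have MRw1 : (fun w => MR (Xv w) (Pi w) * 1)%R = fun w => MR (Xv w) (Pi w).
  by apply/funext => w; rewrite mulr1.
have GMD1 : (fun w => GMD (Xv w) * 1)%R = fun w => GMD (Xv w).
  by apply/funext => w; rewrite mulr1.
have := varMR 1%R; have := varGMD 1%R; have := varcond 1%R.
rewrite MR1 /= MRw1 GMD1 expr1n !mulr1 -v1E -v2E -v3E => -> -> ->.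
rewrite v1E v2E v3E -!EFinM -!(exprVn (d2 R)); split; split => //.
- exact: varMR.
- by rewrite condMR; exact: varGMD.
- exact: varcond.
Qed.
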